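(* Let $\xi\in\mathbb{F}_q((z^{-1}))$ be irrational. For every $\theta\in\mathbb{F}_q((z^{-1}))$ with $\theta\notin\mathbb{F}_q[z]+\xi\mathbb{F}_q[z]$, $$\frac{1}{\omega((\xi))}\le\widehat{\omega}((\xi),\theta)\le\omega((\xi)).$$ Moreover, let $\omega$ be either $+\infty$ or a real number $\ge1$. Then there exists $\xi\in\mathbb{F}_q((z^{-1}))$ with $\omega((\xi))=\omega$ such that the set of values $\{\widehat{\omega}((\xi),\theta):\theta\in\mathbb{F}_q((z^{-1}))\setminus(\mathbb{F}_q[z]+\xi\mathbb{F}_q[z])\}$ is equal to the interval $[1/\omega,\omega]$.
   Context: Let $q$ be a prime power, $\mathbb{F}_q[z]$ the polynomial ring over $\mathbb{F}_q$, $\mathbb{F}_q((z^{-1}))$ the field of formal Laurent series in $z^{-1}$, with $\|x\|=q^{\deg x}$ for $x\ne0$, $\|0\|=0$; irrational means not in $\mathbb{F}_q(z)$; $|\langle x\rangle|=\min_{y\in\mathbb{F}_q[z]}\|x-y\|$. For $\xi,\theta\in\mathbb{F}_q((z^{-1}))$: $\widehat{\omega}((\xi),\theta)$ is the supremum of real $w$ such that for all sufficiently large real $H$ the system $|\langle x\xi-\theta\rangle|\le H^{-w}$, $\|x\|\le H$ has a solution $x\in\mathbb{F}_q[z]$; $\omega((\xi))$ is the supremum of real $w$ such that for arbitrarily large real $H$ the system $|\langle x\xi\rangle|\le H^{-w}$, $\|x\|\le H$ has a nonzero solution $x\in\mathbb{F}_q[z]$. Exponents may be $+\infty$; $1/(+\infty)=0$,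 so for $\omega=+\infty$ the interval is $[0,+\infty]$. *)

(* Defs.v *)
From HB Require Import structures.
From mathcomp Require Import all_boot all_order all_algebra.
From mathcomp Require Import zify.
From mathcomp Require Import mathcomp_extra boolp classical_sets functions.
From mathcomp Require Import cardinality fsbigop reals ereal exp.
Set Implicit Arguments.
Unset Strict Implicit.
Unset Printing Implicit Defensive.
Import Order.TTheory GRing.Theory Num.Theory.
Local Open Scope classical_set_scope.
Local Open Scope ring_scope.

(* [lcoef x n] is the coefficient of z^n, so that [x] stands for
   \sum_(n <= N) (lcoef x n) z^n for some N depending on [x]. *)
Record laurent (K : fieldType) := Laurent {
  lcoef : int -> K;
  _ : exists N : int, forall n, N < n -> lcoef n = 0 }.

HB.instance Definition _ (K : fieldType) := gen_eqMixin (laurent K).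
HB.instance Definition _ (K : fieldType) := gen_choiceMixin (laurent K).

Section LaurentRing.
Variable K : fieldType.
Implicit Types (x y t : laurent K) (a b c n : int).

Definition lbound x a := forall n, a < n -> lcoef x n = 0.

Lemma lboundP x : exists a, lbound x a. Proof. by case: x. Qed.

Lemma laurentP x y : lcoef x =1 lcoef y -> x = y.
Proof.
case: x y => [f hf] [g hg] /= /funext fg; case: _ / fg hg => hg.
by congr Laurent; exact: Prop_irrelevance.
Qed.

Lemma lzero_subproof : exists N : int, forall n, N < n -> (0 : K) = 0.
Proof. by exists 0. Qed.
Definition lzero := Laurent lzero_subproof.

Lemma lopp_subproof x : exists N : int, forall n, N < n -> - lcoef x n = 0.
Proof. by have [a ha] := lboundP x; exists a => n /ha ->; rewrite oppr0. Qed.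
Definition lopp x := Laurent (lopp_subproof x).

Lemma ladd_subproof x y :
  exists N : int, forall n, N < n -> lcoef x n + lcoef y n = 0.
Proof.
have [[a ha] [b hb]] := (lboundP x, lboundP y).
by exists (Num.max a b) => n; rewrite gt_max => /andP[/ha -> /hb ->]; rewrite addr0.
Qed.
Definition ladd x y := Laurent (ladd_subproof x y).

Lemma laddA : associative ladd.
Proof. by move=> x y t; apply: laurentP => n /=; rewrite addrA. Qed.
Lemma laddC : commutative ladd.
Proof. by move=> x y; apply: laurentP => n /=; rewrite addrC. Qed.
Lemma ladd0 : left_id lzero ladd.
Proof. by move=> x; apply: laurentP => n /=; rewrite add0r. Qed.
Lemma laddN : left_inverse lzero lopp ladd.
Proof. by move=> x; apply: laurentP => n /=; rewrite addNr. Qed.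

HB.instance Definition _ := GRing.isZmodule.Build (laurent K) laddA laddC ladd0 laddN.

Lemma lcoef0 n : lcoef (0 : laurent K) n = 0. Proof. by []. Qed.
Lemma lcoefD x y n : lcoef (x + y) n = lcoef x n + lcoef y n. Proof. by []. Qed.
Lemma lcoefN x n : lcoef (- x) n = - lcoef x n. Proof. by []. Qed.
Lemma lcoefB x y n : lcoef (x - y) n = lcoef x n - lcoef y n. Proof. by []. Qed.

(* All but finitely many terms of this sum vanish (lemma [lconvE]). *)
Definition lconv x y n : K := \sum_(i \in [set: int]) lcoef x i * lcoef y (n - i).

Lemma lconv_seq x y n (r : seq int) : uniq r ->
  (forall i, i \notin r -> lcoef x i * lcoef y (n - i) = 0) ->
  lconv x y n = \sum_(i <- r) lcoef x i * lcoef y (n - i).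
Proof.
move=> ur hr; rewrite /lconv (fsbigE r)//; last by move=> i _; exact: hr.
by apply: eq_bigl => i; rewrite in_setT.
Qed.

Lemma lconvE x y a b (m : nat) : lbound x a -> lbound y b ->
  lconv x y (a + b - m%:Z) =
  \sum_(k < m.+1) lcoef x (a - k%:Z) * lcoef y (b - (m - k)%N%:Z).
Proof.
move=> ha hb; rewrite (@lconv_seq _ _ _ [seq a - k%:Z | k <- iota 0 m.+1]).
- rewrite big_map -[iota _ _]/(index_iota 0 m.+1) big_mkord.
  by apply: eq_bigr => k _; congr (_ * lcoef y _); have := ltn_ord k; lia.
- by rewrite map_inj_uniq ?iota_uniq// => i j; lia.
move=> i ni; have [ai|ia] := ltP a i; first by rewrite ha ?mul0r.
have [bi|ib] := ltP b (a + b - m%:Z - i); first by rewrite hb ?mulr0.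
case/mapP: ni; exists `|a - i|%N; last by lia.
by rewrite mem_iota; lia.
Qed.

Lemma lconv_gt x y a b n : lbound x a -> lbound y b -> a + b < n ->
  lconv x y n = 0.
Proof.
move=> ha hb abn; rewrite (@lconv_seq _ _ _ [::]) ?big_nil// => i _.
have [ai|ia] := ltP a i; first by rewrite ha ?mul0r.
by rewrite hb ?mulr0//; lia.
Qed.

Lemma lmul_subproof x y : exists N : int, forall n, N < n -> lconv x y n = 0.
Proof.
have [[a ha] [b hb]] := (lboundP x, lboundP y).
by exists (a + b) => n; exact: lconv_gt.
Qed.
Definition lmul x y := Laurent (lmul_subproof x y).

Lemma lbound_mul x y a b : lbound x a -> lbound y b -> lbound (lmul x y) (a + b).
Proof. by move=> ha hb n; exact: lconv_gt. Qed.

Lemma lone_subproof :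
  exists N : int, forall n, N < n -> (if n == 0 then 1 else 0 : K) = 0.
Proof. by exists 0 => n n0; rewrite gt_eqF. Qed.
Definition lone := Laurent lone_subproof.

Let tr a x N := \poly_(k < N) lcoef x (a - k%:Z).

Let lmul_tr x y a b m N : lbound x a -> lbound y b -> (m < N)%N ->
  lcoef (lmul x y) (a + b - m%:Z) = (tr a x N * tr b y N)`_m.
Proof.
move=> ha hb mN; rewrite /= (lconvE _ ha hb) coefM; apply: eq_bigr => k _.
have km := ltn_ord k.
by rewrite !coef_poly !ifT//; lia.
Qed.

Lemma lcoef_eq_bound x y a : lbound x a -> lbound y a ->
  (forall m : nat, lcoef x (a - m%:Z) = lcoef y (a - m%:Z)) -> x = y.
Proof.
move=> hx hy xy; apply: laurentP => n; have [an|na] := ltP a n.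
  by rewrite hx ?hy.
by have := xy `|a - n|%N; have -> : a - `|a - n|%N%:Z = n by lia.
Qed.

Let coefM_eq (p p' q q' : {poly K}) m :
  (forall i, (i <= m)%N -> p`_i = p'`_i) -> (forall i, (i <= m)%N -> q`_i = q'`_i) ->
  (p * q)`_m = (p' * q')`_m.
Proof.
move=> pp' qq'; rewrite !coefM; apply: eq_bigr => k _.
by rewrite pp' ?qq' ?leq_subr// -ltnS.
Qed.

Lemma lmulC : commutative lmul.
Proof.
move=> x y; have [[a ha] [b hb]] := (lboundP x, lboundP y).
apply: (@lcoef_eq_bound _ _ (a + b)); first exact: lbound_mul.
  by rewrite addrC; exact: lbound_mul.
move=> m; rewrite (lmul_tr ha hb (ltnSn m)) mulrC [in RHS](addrC a).
by rewrite (lmul_tr hb ha (ltnSn m)).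
Qed.

Lemma lmulA : associative lmul.
Proof.
move=> x y t.
have [[a ha] [b hb] [c hc]] := And3 (lboundP x) (lboundP y) (lboundP t).
have hyt := lbound_mul hb hc; have hxy := lbound_mul ha hb.
apply: (@lcoef_eq_bound _ _ (a + b + c)).
- by rewrite -addrA; exact: lbound_mul.
- exact: lbound_mul.
move=> m; rewrite (lmul_tr hxy hc (ltnSn m)) -(addrA a b c).
rewrite (lmul_tr ha hyt (ltnSn m)).
transitivity ((tr a x m.+1 * (tr b y m.+1 * tr c t m.+1))`_m).
  apply: coefM_eq => // i im.
  by rewrite coef_poly ltnS im (@lmul_tr _ _ _ _ _ m.+1).
rewrite mulrA; apply: coefM_eq => // i im.
by rewrite [in RHS]coef_poly ltnS im (@lmul_tr _ _ _ _ _ m.+1).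
Qed.

Lemma lbound1 : lbound lone 0.
Proof. by move=> n n0 /=; rewrite gt_eqF. Qed.

Lemma lmul1 : left_id lone lmul.
Proof.
move=> x; have [a ha] := lboundP x; apply: laurentP => n /=.
rewrite (@lconv_seq _ _ _ [:: 0])//; first by rewrite big_seq1 /= mul1r subr0.
by move=> i; rewrite inE /= => /negPf ->; rewrite mul0r.
Qed.

Lemma lbound_le x a b : a <= b -> lbound x a -> lbound x b.
Proof. by move=> ab ha n bn; apply: ha; exact: le_lt_trans bn. Qed.

Lemma lbound_add x y a : lbound x a -> lbound y a -> lbound (x + y) a.
Proof. by move=> ha hb n an; rewrite lcoefD ha ?hb ?addr0. Qed.

Lemma lmulDl : left_distributive lmul +%R.
Proof.
move=> x y t.
have [[a ha] [b hb] [c hc]] := And3 (lboundP x) (lboundP y) (lboundP t).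
have hx : lbound x (Num.max a b) by apply: lbound_le ha; rewrite le_max lexx.
have hy : lbound y (Num.max a b) by apply: lbound_le hb; rewrite le_max lexx orbT.
have hxy := lbound_add hx hy.
apply: (@lcoef_eq_bound _ _ (Num.max a b + c)); first exact: lbound_mul.
  by apply: lbound_add; exact: lbound_mul.
move=> m; rewrite lcoefD /= !lconvE// -big_split; apply: eq_bigr => k _.
by rewrite lcoefD mulrDl.
Qed.

Lemma lone_neq0 : lone != 0.
Proof.
apply/eqP => /(congr1 (fun x => lcoef x 0)) /= /eqP.
by rewrite oner_eq0.
Qed.

HB.instance Definition _ := GRing.Zmodule_isComNzRing.Build (laurent K)
  lmulA lmulC lmul1 lmulDl lone_neq0.

(* Degree with respect to z; the value at [x = 0] is irrelevant. *)
Definition ldeg x : int :=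
  xget 0 [set n : int | lcoef x n != 0 /\ lbound x n].

Lemma ldegP x : x != 0 -> lcoef x (ldeg x) != 0 /\ lbound x (ldeg x).
Proof.
move=> x0; apply: (@xgetPex _ 0 [set n : int | lcoef x n != 0 /\ lbound x n]).
have [a ha] := lboundP x.
have ex : exists m : nat, lcoef x (a - m%:Z) != 0.
  apply: contrapT => nex; move/eqP: x0; apply.
  apply: (@lcoef_eq_bound _ _ a) => // m.
  by rewrite lcoef0; apply/eqP/negPn/negP => xm; apply: nex; exists m.
case: (ex_minnP ex) => m xm mmin; exists (a - m%:Z); split => // n mn.
have [an|na] := ltP a n; first exact: ha.
apply/eqP/negPn/negP => xn.
have /mmin : lcoef x (a - `|a - n|%N%:Z) != 0 by have -> : a - `|a - n|%N%:Z = n by lia.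
by lia.
Qed.

Lemma ldegE x n : lcoef x n != 0 -> lbound x n -> ldeg x = n.
Proof.
move=> xn hn; apply: xget_unique => // m [xm hm].
apply/eqP; rewrite eq_le !leNgt; apply/andP; split; apply/negP.
  by move=> nm; rewrite (hn _ nm) eqxx in xm.
by move=> mn; rewrite (hm _ mn) eqxx in xn.
Qed.

(* Coefficients of the inverse: with [d = ldeg x] and [y_m] the coefficient of
   z^(- d - m) in the inverse, [y_0 .. y_(n-1)] are computed in turn. *)
Fixpoint linv_seq x (n : nat) : seq K :=
  if n isn't m.+1 then [::] else
  let s := linv_seq x m in
  rcons s ((lcoef x (ldeg x))^-1 *
    ((if m == 0%N then 1 else 0) -
     \sum_(k < m) lcoef x (ldeg x - (m - k)%N%:Z) * s`_k)).

Definition linv_coef x n : K :=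
  if (x == 0) || (- ldeg x < n) then 0
  else let m := absz (ldeg x + n) in (linv_seq x m.+1)`_m.

Lemma linv_subproof x : exists N : int, forall n, N < n -> linv_coef x n = 0.
Proof. by exists (- ldeg x) => n dn; rewrite /linv_coef dn orbT. Qed.
Definition linv x := Laurent (linv_subproof x).

Lemma size_linv_seq x (n : nat) : size (linv_seq x n) = n.
Proof. by elim: n => //= n IHn; rewrite size_rcons IHn. Qed.

Lemma nth_linv_seq x (n k : nat) : (k < n)%N ->
  (linv_seq x n)`_k = (linv_seq x k.+1)`_k.
Proof.
elim: n => // n IHn; rewrite ltnS leq_eqVlt => /predU1P[->//|kn].
by rewrite [LHS]/= nth_rcons size_linv_seq kn IHn.
Qed.

Lemma lmulVf x : x != 0 -> linv x * x = 1.
Proof.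
move=> x0; have [xd hd] := ldegP x0; set d := ldeg x in xd hd.
have hi : lbound (linv x) (- d) by move=> n dn; rewrite /= /linv_coef dn orbT.
apply: (@lcoef_eq_bound _ _ (d - d)); first by rewrite mulrC; exact: lbound_mul.
  by rewrite subrr; exact: lbound1.
move=> m; rewrite mulrC [LHS](lconvE _ hd hi) (reindex_inj rev_ord_inj) /=.
have iE (k : nat) : linv_coef x (- d - k%:Z) = (linv_seq x k.+1)`_k.
  rewrite /linv_coef (negPf x0) ifF; last by rewrite -/d; lia.
  by have -> : absz (ldeg x + (- d - k%:Z)) = k by rewrite -/d; lia.
rewrite big_ord_recr /= subSS subnn subr0 subn0 iE [X in X`_m]/=.
rewrite nth_rcons size_linv_seq ltnn eqxx mulrA divff// mul1r.
rewrite subrr sub0r oppr_eq0 -[X in _ = if X then _ else _]/(m == 0%N).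
under eq_bigr => k _.
  have km := ltn_ord k.
  rewrite subSS subKn ?(ltnW km)// iE -(@nth_linv_seq x m k km) -/d.
  over.
by rewrite addrC subrK.
Qed.

Lemma linv0 : linv 0 = 0.
Proof. by apply: laurentP => n /=; rewrite /linv_coef eqxx. Qed.

HB.instance Definition _ := GRing.ComNzRing_isField.Build (laurent K) lmulVf linv0.

(* The embedding of K[z] in K((z^-1)). *)
Lemma lpoly_subproof (p : {poly K}) :
  exists N : int, forall n, N < n -> (if n is Posz m then p`_m else 0) = 0.
Proof.
by exists (size p)%:Z => -[m|//]; rewrite ltz_nat => /ltnW; exact: nth_default.
Qed.
Definition lpoly (p : {poly K}) : laurent K := Laurent (lpoly_subproof p).

Lemma lpoly_is_zmod_morphism : zmod_morphism lpoly.
Proof.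
move=> p q; apply: laurentP => -[n|n]; rewrite lcoefB /= ?subr0//.
exact: coefB.
Qed.

Lemma lpoly_is_monoid_morphism : monoid_morphism lpoly.
Proof.
split; first by apply: laurentP => -[[|n]|n] /=; rewrite ?coef1.
move=> p q; apply: laurentP => -[n|n] /=; last first.
  rewrite (@lconv_seq _ _ _ [::]) ?big_nil// => -[i|i] _ /=; last by rewrite mul0r.
  by rewrite (_ : Negz n - i%:Z = Negz (n + i)) ?mulr0//; lia.
rewrite (@lconv_seq _ _ _ [seq Posz k | k <- iota 0 n.+1]).
- rewrite big_map -[iota _ _]/(index_iota 0 n.+1) big_mkord coefM.
  by apply: eq_bigr => k _ /=; rewrite subzn// -ltnS.
- by rewrite map_inj_uniq ?iota_uniq// => i j [].
move=> [i|i]; last by rewrite /= mul0r.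
have [lein|ltni _] := leqP i n; first by rewrite map_f// mem_iota.
by rewrite /= (_ : n%:Z - i%:Z = Negz (i - n).-1) ?mulr0//; lia.
Qed.

HB.instance Definition _ :=
  GRing.isZmodMorphism.Build {poly K} (laurent K) lpoly lpoly_is_zmod_morphism.
HB.instance Definition _ :=
  GRing.isMonoidMorphism.Build {poly K} (laurent K) lpoly lpoly_is_monoid_morphism.

Definition lrational x := exists p q : {poly K}, q != 0 /\ x = lpoly p / lpoly q.

(* The set K[z] + x K[z]. *)
Definition lpolyspan x : set (laurent K) :=
  [set t | exists p q : {poly K}, t = lpoly p + x * lpoly q].

Lemma lpoly_inj : injective lpoly.
Proof.
move=> p q /(congr1 (@lcoef K)) /= pq; apply/polyP => i.
by have := congr1 (fun f => f (Posz i)) pq.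
Qed.

Lemma lpoly_eq0 p : (lpoly p == 0) = (p == 0).
Proof. by rewrite -(inj_eq lpoly_inj) rmorph0. Qed.

Lemma ldeg_lpoly p : p != 0 -> ldeg (lpoly p) = (size p).-1%:Z.
Proof.
move=> p0; apply: ldegE => [|[n|//]] /=; first by rewrite -lead_coefE lead_coef_eq0.
by move=> pn; apply: nth_default; have := size_poly_gt0 p; rewrite p0; lia.
Qed.

End LaurentRing.

Section Exponents.
Variables (F : finFieldType) (R : realType).
Implicit Types (x y xi theta : laurent F) (H w : R).

Definition lnorm x : R := if x == 0 then 0 else #|F|%:R ^ ldeg x.

(* The distance from [x] to F[z]; the infimum is a minimum ([ldist_min]). *)
Definition ldist x : R := inf [set lnorm (x - lpoly p) | p in [set: {poly F}]].

Lemma lnorm_ge0 x : 0 <= lnorm x.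
Proof. by rewrite /lnorm; case: ifP => // _; rewrite exprz_ge0. Qed.

Lemma card_field_gt1 : 1 < #|F|%:R :> R.
Proof.
by rewrite ltr1n (cardD1 0) (cardD1 1) !inE /= oner_eq0.
Qed.

Lemma lfrac_subproof x :
  exists N : int, forall n, N < n -> (if n is Posz _ then 0 else lcoef x n) = 0.
Proof. by exists 0 => -[]. Qed.
Definition lfrac x := Laurent (lfrac_subproof x).

Lemma lfracE x : exists p, x - lpoly p = lfrac x.
Proof.
have [a ha] := lboundP x.
exists (\poly_(i < `|a|%N.+1) lcoef x i%:Z); apply: laurentP => -[n|n].
  rewrite lcoefB /= coef_poly; case: ifP => [_|an]; first by rewrite subrr.
  by rewrite ha ?subrr//; lia.
by rewrite lcoefB /= subr0.
Qed.

Lemma lnorm_lfrac_le x p : lnorm (lfrac x) <= lnorm (x - lpoly p).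
Proof.
rewrite {1}/lnorm; case: eqVneq => [_|f0]; first exact: lnorm_ge0.
have [fd hf] := ldegP f0.
have [m dE] : exists m, ldeg (lfrac x) = Negz m.
  by move: fd; case: (ldeg _) => [n|m] /=; [rewrite eqxx|exists m].
have xd : lcoef (x - lpoly p) (ldeg (lfrac x)) != 0.
  by move: fd; rewrite dE lcoefB /= subr0.
have x0 : x - lpoly p != 0 by apply: contraNneq xd => ->; rewrite lcoef0.
rewrite /lnorm (negPf x0) ler_weXz2l ?(ltW card_field_gt1)//.
rewrite leNgt; apply/negP => lt; case: (ldegP x0) => _ /(_ _ lt).
exact/eqP.
Qed.

Lemma ldist_min x : exists p,
  ldist x = lnorm (x - lpoly p) /\ forall p', ldist x <= lnorm (x - lpoly p').
Proof.
have [p pE] := lfracE x; exists p.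
suff dE : ldist x = lnorm (x - lpoly p).
  by split=> // p'; rewrite dE pE; exact: lnorm_lfrac_le.
apply/eqP; rewrite eq_le; apply/andP; split.
  apply: ge_inf; last by exists p.
  by exists 0 => _ [p' _ <-]; exact: lnorm_ge0.
apply: lb_le_inf; first by exists (lnorm (x - lpoly p)), p.
by move=> _ [p' _ <-]; rewrite pE; exact: lnorm_lfrac_le.
Qed.

Definition omega xi : \bar R :=
  ereal_sup [set w%:E | w in
    [set w : R | forall H0, exists2 H, H0 <= H &
      exists x : {poly F}, [/\ x != 0,
        ldist (lpoly x * xi) <= H `^ (- w) & lnorm (lpoly x) <= H]]].

Definition omegahat xi theta : \bar R :=
  ereal_sup [set w%:E | w in
    [set w : R | exists H0, forall H, H0 <= H ->
      exists x : {poly F},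
        ldist (lpoly x * xi - theta) <= H `^ (- w) /\ lnorm (lpoly x) <= H]].

End Exponents.

(* Main.v *)
Require Import Defs.
From mathcomp Require Import all_boot all_order all_algebra.
From mathcomp Require Import zify ring lra.
From mathcomp Require Import boolp classical_sets set_interval reals ereal exp.
Import Defs.
Set Implicit Arguments.
Unset Strict Implicit.
Unset Printing Implicit Defensive.
Import Order.TTheory GRing.Theory Num.Theory.
Local Open Scope classical_set_scope.
Local Open Scope ring_scope.

(* The homogeneous and inhomogeneous systems are dual: x of degree < n is sent to
   the first m fractional digits of x xi by a Hankel matrix, which is onto iff its
   transpose is injective, that is iff the homogeneous system has no nonzero
   solution y of degree < m with |<y xi>| < q^(-n).  This gives the lower bound.
   For the upper bound, subtract the inhomogeneous solutions for consecutive
   H = q^n: if they are eventually constant, theta lies in F[z] + xi F[z], and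
   otherwise their differences solve the homogeneous system.

   For the second part, let xi be the continued fraction whose convergents p_k/q_k
   have denominators of degree d_k, with d_(k+1)/d_k tending to omega, and put
   D_k = q_k xi - p_k, of degree -d_(k+1).  For
   theta = \sum_k z^(e_k) D_k with 0 <= e_k < d_(k+1) - d_k, the best approximations
   are the partial sums, so that the uniform exponent is the limit of
   (d_(k+1) - e_k) / (d_k + e_k), which e_k steers to any value of
   [1/omega, omega]. *)

(** * Degrees, leading terms and limits of Laurent series *)

Section LaurentDegree.
Variable K : fieldType.
Implicit Types (x y : laurent K) (a b : int) (p : {poly K}).

Lemma lboundN x a : lbound x a -> lbound (- x) a.
Proof. by move=> hx n an; rewrite lcoefN hx ?oppr0. Qed.

Lemma lboundB x y a : lbound x a -> lbound y a -> lbound (x - y) a.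
Proof. by move=> hx hy; apply: lbound_add => //; apply: lboundN. Qed.

Lemma lboundM x y a b : lbound x a -> lbound y b -> lbound (x * y) (a + b).
Proof. exact: lbound_mul. Qed.

Lemma lcoefM_top x y a b : lbound x a -> lbound y b ->
  lcoef (x * y) (a + b) = lcoef x a * lcoef y b.
Proof.
move=> hx hy; have := lconvE 0 hx hy; rewrite subr0 => /= ->.
by rewrite big_ord1 /= !subr0.
Qed.

Lemma lbound_poly p (n : nat) : (size p <= n.+1)%N -> lbound (lpoly p) n.
Proof.
by move=> sp [m|m] nm //=; rewrite nth_default//; apply: leq_trans sp _; lia.
Qed.

Lemma lbound_poly_lt0 p a : a < 0 -> lbound (lpoly p) a -> p = 0.
Proof.
move=> a0 hp; apply/polyP => i; rewrite coef0.
apply: (hp i%:Z); lia.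
Qed.

Lemma lbound_polyP p (n : nat) : lbound (lpoly p) n -> (size p <= n.+1)%N.
Proof. by move=> hp; apply/leq_sizeP => j nj; have /= := hp j; apply; lia. Qed.

(** A relational form of [ldeg x = a] that also forces [x] to be nonzero, so that no default degree
    of 0 interferes. *)
Definition leads x a := lcoef x a != 0 /\ lbound x a.

Lemma leads_neq0 x a : leads x a -> x != 0.
Proof. by case=> xa _; apply: contraNneq xa => ->; rewrite lcoef0. Qed.

Lemma leads_lbound_le x a b : leads x a -> lbound x b -> a <= b.
Proof. by case=> xa _ hb; rewrite leNgt; apply: contra xa => /hb ->. Qed.

Lemma leadsM x y a b : leads x a -> leads y b -> leads (x * y) (a + b).
Proof.
move=> [xa hx] [yb hy]; split; last exact: lboundM.
by rewrite lcoefM_top// mulf_neq0.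
Qed.

Lemma leadsD x y a b : b < a -> leads x a -> lbound y b -> leads (x + y) a.
Proof.
move=> ba [xa hx] hy; split; first by rewrite lcoefD hy ?addr0.
by apply: lbound_add => //; apply: lbound_le hy; exact: ltW.
Qed.

Lemma leadsN x a : leads x a -> leads (- x) a.
Proof. by case=> xa hx; split; [rewrite lcoefN oppr_eq0|exact: lboundN]. Qed.

Lemma leads1 : leads 1 0.
Proof. by split; [rewrite /= oner_eq0|exact: lbound1]. Qed.

Lemma leadsV x a : leads x a -> leads x^-1 (- a).
Proof.
move=> hx; have x0 := leads_neq0 hx.
have hv : leads x^-1 (ldeg x^-1) by apply: ldegP; rewrite invr_eq0.
have := leadsM hx hv; rewrite divff// => h1.
have e : a + ldeg x^-1 = 0.
  by apply: le_anti; rewrite (leads_lbound_le h1 leads1.2) (leads_lbound_le leads1 h1.2).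
by have -> : - a = ldeg x^-1 by lia.
Qed.

Lemma leads_poly p (n : nat) : size p = n.+1 -> leads (lpoly p) n.
Proof.
move=> sp; split; last by apply: lbound_poly; rewrite sp.
by rewrite /= -[n]/(n.+1.-1) -sp -lead_coefE lead_coef_eq0 -size_poly_eq0 sp.
Qed.

(** Completeness: later steps change only coefficients of ever lower degree. Since [k <= c k], the
    coefficient of z^n is final from index [|n|.+1] on, and the limit reads it there. *)
Lemma lcoef_limit (s : nat -> laurent K) (c : nat -> nat) :
  (forall k, (c k < c k.+1)%N) ->
  (forall k, lbound (s k.+1 - s k) (- (c k)%:Z)) ->
  exists x, forall k, lbound (x - s k) (- (c k)%:Z).
Proof.
move=> cmono hs.
have ck k : (k <= c k)%N by elim: k => // k; have := cmono k; lia.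
have clt j k : (j <= k)%N -> (c j <= c k)%N.
  move=> jk; rewrite -(subnKC jk); elim: (k - j)%N => [|i IH]; first by rewrite addn0.
  by rewrite addnS; apply: leq_trans IH (ltnW (cmono _)).
have hst j k : (j <= k)%N -> lbound (s k - s j) (- (c j)%:Z).
  elim: k => [|k IH]; first by rewrite leqn0 => /eqP->; rewrite subrr.
  rewrite leq_eqVlt => /predU1P[->|jk]; first by rewrite subrr.
  rewrite -(subrK (s k) (s k.+1)) -addrA; apply: lbound_add; last exact: IH.
  by apply: lbound_le (hs k); have := clt j k; lia.
have stable j k n : (j <= k)%N -> - (c j)%:Z < n -> lcoef (s k) n = lcoef (s j) n.
  by move=> jk jn; apply/eqP; rewrite -subr_eq0 -lcoefB hst.
have [a ha] := lboundP (s 0%N).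
have sub : exists N : int, forall n, N < n -> lcoef (s `|n|.+1%N) n = 0.
  exists (Num.max a 0) => n; rewrite gt_max => /andP[an n0].
  by rewrite (stable 0%N) ?ha//; lia.
exists (Laurent sub) => k n kn; rewrite lcoefB /=.
have [nk|kn'] := leqP k `|n|.+1; first by rewrite (stable k) ?subrr.
by rewrite -(stable `|n|.+1 k) ?subrr//; [lia | have := ck `|n|.+1; lia].
Qed.

(** The tail after step [k.+1] has smaller degree than the jump at step [k], so the jump alone
    decides the leading term. *)
Lemma leads_limit (s : nat -> laurent K) (c : nat -> nat) :
  (forall k, (c k < c k.+1)%N) ->
  (forall k, leads (s k.+1 - s k) (- (c k)%:Z)) ->
  exists x, forall k, leads (x - s k) (- (c k)%:Z).
Proof.
move=> cmono hs; have [x hx] := lcoef_limit cmono (fun k => (hs k).2).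
exists x => k; have -> : x - s k = (s k.+1 - s k) + (x - s k.+1).
  by rewrite [RHS]addrC addrA subrK.
by apply: leadsD (hs k) (hx k.+1); have := cmono k; lia.
Qed.

End LaurentDegree.

(** * Continued fractions with prescribed denominator degrees, and series in their remainders *)

Section Approximations.
Variable K : fieldType.

(* Consecutive denominators (resp. numerators) of the continued fraction with
   partial quotients 'X^(g 0), 'X^(g 1), ... and zero integral part. *)
Fixpoint cf_den (g : nat -> nat) (k : nat) : {poly K} * {poly K} :=
  if k is j.+1 then
    let: (a, b) := cf_den g j in (b, 'X^(g j) * b + a)
  else (0, 1).

Fixpoint cf_num (g : nat -> nat) (k : nat) : {poly K} * {poly K} :=
  if k is j.+1 then
    let: (a, b) := cf_num g j in (b, 'X^(g j) * b + a)
  else (1, 0).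

Variable d : nat -> nat.
Hypothesis d_mono : forall k, (d k < d k.+1)%N.

(** By the determinant identity, consecutive convergents differ by a sign over q_k q_(k+1), of
    degree -(d_k + d_(k+1)). These degrees decrease, so the convergents have a limit xi, and
    multiplying the error by q_k gives the claim. *)
Lemma exists_convergents : d 0%N = 0%N -> exists (xi : laurent K) (q p : nat -> {poly K}),
  forall k, size (q k) = (d k).+1 /\
    leads (lpoly (q k) * xi - lpoly (p k)) (- (d k.+1)%:Z).
Proof.
move=> d0; pose g k := (d k.+1 - d k)%N.
pose q k := (cf_den g k).2; pose p k := (cf_num g k).2.
have sq k : size (q k) = (d k).+1 /\ (size (cf_den g k).1 <= d k)%N.
  elim: k => [|k]; first by rewrite /q /= size_poly1 size_poly0 d0.
  rewrite /q /=; case: (cf_den g k) => a b /= [sb sa].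
  have dk := d_mono k.
  have sX : size ('X^(g k) * b) = (d k.+1).+1.
    by rewrite mulrC size_mulXn -?size_poly_gt0 sb// /g; lia.
  by split; [rewrite size_polyDl sX//; apply: leq_ltn_trans sa _; lia | rewrite ?sb; lia].
have det k : (cf_num g k.+1).2 * (cf_den g k).2 -
    (cf_num g k).2 * (cf_den g k.+1).2 = (-1) ^+ k.
  (* The determinant within one state of the recursion changes sign at each step; the one wanted
     compares two successive states. *)
  have -> : (-1) ^+ k = (cf_num g k).1 * (cf_den g k).2 -
     (cf_num g k).2 * (cf_den g k).1 :> {poly K}.
    elim: k => [|k] /=; first by rewrite mul1r mulr0 subr0.
    case: (cf_num g k) => a b /=; case: (cf_den g k) => a' b' /=.
    by rewrite exprS => ->; ring.
  by move=> /=; case: (cf_num g k) => a b /=; case: (cf_den g k) => a' b' /=; ring.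
pose c k := (d k + d k.+1)%N.
have lq k : leads (lpoly (q k)) (d k) by apply: leads_poly; case: (sq k).
have q0 k : lpoly (q k) != 0 := leads_neq0 (lq k).
have hs k : leads (lpoly (p k.+1) / lpoly (q k.+1) - lpoly (p k) / lpoly (q k))
    (- (c k)%:Z).
  have -> : lpoly (p k.+1) / lpoly (q k.+1) - lpoly (p k) / lpoly (q k) =
      (-1) ^+ k * (lpoly (q k) * lpoly (q k.+1))^-1.
    have -> : (-1) ^+ k = lpoly ((-1) ^+ k) :> laurent K.
      by rewrite rmorphXn rmorphN1.
    rewrite -(det k) rmorphB !rmorphM /=; have := q0 k; have := q0 k.+1.
    by rewrite /q /p /= => h1 h2; field; rewrite h1 h2.
  have -> : - (c k)%:Z = 0 + - ((d k)%:Z + (d k.+1)%:Z) by rewrite /c; lia.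
  apply: leadsM; last by apply: leadsV; apply: leadsM.
  by rewrite -signr_odd; case: (odd k); [apply: leadsN|]; exact: leads1.
have [|xi hxi] := leads_limit (c := c) _ hs.
  by move=> k; rewrite /c; have := d_mono k; have := d_mono k.+1; lia.
exists xi, q, p => k; split; first by case: (sq k).
have -> : lpoly (q k) * xi - lpoly (p k) =
    lpoly (q k) * (xi - lpoly (p k) / lpoly (q k)).
  by rewrite mulrBr mulrCA divff ?mulr1.
have -> : - (d k.+1)%:Z = (d k)%:Z + - (c k)%:Z by rewrite /c; lia.
exact: leadsM.
Qed.

Variables (xi : laurent K) (q p : nat -> {poly K}).
Hypothesis xi_conv : forall k, size (q k) = (d k).+1 /\
  leads (lpoly (q k) * xi - lpoly (p k)) (- (d k.+1)%:Z).

Let D k := lpoly (q k) * xi - lpoly (p k).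
Let lq k : leads (lpoly (q k)) (d k).
Proof. by apply: leads_poly; case: (xi_conv k). Qed.
Let lD k : leads (D k) (- (d k.+1)%:Z).
Proof. by case: (xi_conv k). Qed.

(* x D_k - q_k (x xi - y) = q_k y - p_k x is a polynomial, so it vanishes as soon
   as its degree is negative. *)
Lemma convergent_cross k (x y : {poly K}) a b :
  lbound (lpoly x) a -> lbound (lpoly x * xi - lpoly y) b ->
  a < (d k.+1)%:Z -> (d k)%:Z + b < 0 ->
  lpoly x * D k = lpoly (q k) * (lpoly x * xi - lpoly y).
Proof.
move=> hx hy ad db; apply/eqP; rewrite -subr_eq0.
have E : lpoly x * D k - lpoly (q k) * (lpoly x * xi - lpoly y) =
    lpoly (q k * y - p k * x).
  by rewrite rmorphB !rmorphM /= /D; ring.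
rewrite E lpoly_eq0; apply/eqP/(@lbound_poly_lt0 _ _ (-1)) => //; rewrite -E.
apply: lboundB.
  by apply: lbound_le (lboundM hx (lD k).2); lia.
by apply: lbound_le (lboundM (lq k).2 hy); lia.
Qed.

(** If d_j <= deg x < d_(j+1), comparing degrees in [convergent_cross] would give deg x < d_j. An
    [x] of smaller degree falls under a smaller index, where the forbidden bound is weaker. *)
Lemma homogeneous_lower k (x y : {poly K}) :
  d 0%N = 0%N -> x != 0 -> (size x <= d k.+1)%N ->
  ~ lbound (lpoly x * xi - lpoly y) (- (d k.+1)%:Z - 1).
Proof.
move=> d0 x0.
have s0 : (0 < size x)%N by rewrite size_poly_gt0.
have lx : leads (lpoly x) (size x).-1 by apply: leads_poly; rewrite prednK.
have key j : (d j < size x <= d j.+1)%N ->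
    ~ lbound (lpoly x * xi - lpoly y) (- (d j.+1)%:Z - 1).
  move=> /andP[dx xd] hy.
  have E := convergent_cross (k := j) lx.2 hy.
  have := leads_lbound_le (leadsM lx (lD j)) (b := (d j)%:Z + (- (d j.+1)%:Z - 1)).
  by rewrite E; [|lia..]; move=> /(_ (lboundM (lq j).2 hy)); lia.
elim: k => [|k IH] sx; first by apply: key; rewrite d0 s0.
have [sx'|sx'] := leqP (size x) (d k.+1); last by apply: key; rewrite sx'.
by move=> hy; apply: IH => //; apply: lbound_le hy; have := d_mono k.+1; lia.
Qed.

Variable e : nat -> nat.
Hypothesis e_lt : forall k, (e k < d k.+1 - d k)%N.

(** Here theta is the sum of z^(e_k) D_k. The degrees e_k - d_(k+1) strictly decrease by [e_lt], so
    the error of a partial sum has the degree of its first omitted term. *)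
Lemma exists_inhomogeneous : exists (theta : laurent K) (X Y : nat -> {poly K}),
  forall k, leads (theta - (lpoly (X k) * xi - lpoly (Y k)))
      (- (d k.+1 - e k)%N%:Z) /\
    (size (X k) <= d k)%N /\ (size (X k.+1) <= (d k + e k).+1)%N.
Proof.
pose X k : {poly K} := \sum_(j < k) 'X^(e j) * q j.
pose Y k : {poly K} := \sum_(j < k) 'X^(e j) * p j.
have hs k : leads ((lpoly (X k.+1) * xi - lpoly (Y k.+1)) -
    (lpoly (X k) * xi - lpoly (Y k))) (- (d k.+1 - e k)%N%:Z).
  rewrite /X /Y !big_ord_recr /= !rmorphD !rmorphM /=.
  set A := lpoly (X k); set B := lpoly (Y k); set Z := lpoly 'X^(e k).
  have -> : (A + Z * lpoly (q k)) * xi - (B + Z * lpoly (p k)) - (A * xi - B)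
     = Z * D k by rewrite /D; ring.
  have -> : - (d k.+1 - e k)%N%:Z = (e k)%:Z + - (d k.+1)%:Z.
    by have := d_mono k; have := e_lt k; lia.
  by apply: leadsM => //; apply: leads_poly; rewrite size_polyXn.
have [|theta ht] := leads_limit (c := fun k => (d k.+1 - e k)%N) _ hs.
  move=> k; have := d_mono k; have := d_mono k.+1.
  by have := e_lt k; have := e_lt k.+1; lia.
have sX k : (size (X k) <= d k)%N /\ (size (X k.+1) <= (d k + e k).+1)%N.
  have step j : (size (X j) <= d j)%N -> (size (X j.+1) <= (d j + e j).+1)%N.
    move=> sj; rewrite /X big_ord_recr /=; apply: leq_trans (size_polyD _ _) _.
    rewrite geq_max; apply/andP; split; first by apply: leq_trans sj _; lia.
    rewrite mulrC size_mulXn -?size_poly_gt0 (xi_conv j).1//; lia.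
  suff sk : (size (X k) <= d k)%N by split=> //; exact: step.
  elim: k => [|k IH]; first by rewrite /X big_ord0 size_poly0.
  by apply: leq_trans (step _ IH) _; have := d_mono k; have := e_lt k; lia.
by exists theta, X, Y.
Qed.

(** A better [x] would make [x - X] a homogeneous approximation of degree exactly e_k - d_(k+1),
    while deg (x - X) < d_k + e_k; the two sides of [convergent_cross] then have different
    degrees. *)
Lemma inhomogeneous_lower (theta : laurent K) k (X Y x y : {poly K}) :
  leads (theta - (lpoly X * xi - lpoly Y)) (- (d k.+1 - e k)%N%:Z) ->
  (size X <= d k)%N -> (size x <= d k + e k)%N ->
  ~ lbound (lpoly x * xi - theta - lpoly y) (- (d k.+1 - e k)%N%:Z - 1).
Proof.
move=> ht sX sx hy; have dm := d_mono k; have de := e_lt k.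
have lXY : leads (lpoly (x - X) * xi - lpoly (y - Y)) (- (d k.+1 - e k)%N%:Z).
  have -> : lpoly (x - X) * xi - lpoly (y - Y) =
      (theta - (lpoly X * xi - lpoly Y)) + (lpoly x * xi - theta - lpoly y).
    by rewrite !rmorphB /=; ring.
  by apply: leadsD ht hy; lia.
have bx : lbound (lpoly (x - X)) ((d k)%:Z + (e k)%:Z - 1).
  move=> [n|//] nk; apply: nth_default.
  apply: leq_trans (size_polyD _ _) _; rewrite size_polyN geq_max.
  by apply/andP; split; [apply: leq_trans sx _|apply: leq_trans sX _]; lia.
have E := convergent_cross (k := k) bx lXY.2.
have := leads_lbound_le (leadsM (lq k) lXY)
  (b := (d k)%:Z + (e k)%:Z - 1 + (- (d k.+1)%:Z)).
rewrite -E; [|lia..]; move=> /(_ (lboundM bx (lD k).2)); lia.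
Qed.

End Approximations.

(** * Comparison of extended reals through reals, and bracketing by an unbounded sequence *)

Lemma lee_real (R : realType) (a b : \bar R) :
  (forall r : R, (r%:E < a)%E -> (r%:E <= b)%E) -> (a <= b)%E.
Proof.
move=> h; rewrite leNgt; apply/negP => ba.
suff [r rb ra] : exists2 r : R, (b < r%:E)%E & (r%:E < a)%E.
  by have := h r ra; rewrite leNgt rb.
case: a b ba {h} => [a||] [b||] //=.
- by rewrite lte_fin => ba; exists ((a + b) / 2); rewrite lte_fin; lra.
- by move=> _; exists (a - 1); rewrite ?ltNyr// lte_fin; lra.
- by move=> _; exists (b + 1); rewrite ?ltry// lte_fin; lra.
- by move=> _; exists 0; rewrite ?ltNyr ?ltry.
Qed.

(** [f] need not be monotone: the index sought precedes the first one from [K] on where [f] exceeds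
    [h]. *)
Lemma unbounded_bracket (R : realType) (f : nat -> R) (K : nat) (h : R) :
  (forall k, k%:R <= f k) -> f K <= h -> exists2 k, (K <= k)%N & f k <= h < f k.+1.
Proof.
move=> fk fKh.
have ex : exists n, h < f (K + n)%N.
  exists (Num.bound h); apply: lt_le_trans (fk _).
  have := archi_boundP (normr_ge0 h); rewrite natrD.
  by have := unstable.ltr_bound h; have := ler0n R K; lra.
case: (ex_minnP ex) => -[|m] hm mmin; first by move: hm; rewrite addn0 ltNge fKh.
exists (K + m)%N; first exact: leq_addr.
rewrite -addnS hm andbT leNgt; apply/negP => /mmin; by rewrite ltnn.
Qed.

(** * Exponents on a logarithmic scale, and the upper bound *)

Section LogScale.
Variables (F : finFieldType) (R : realType).
Implicit Types (x xi theta : laurent F) (r w h : R).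
Local Notation q := (#|F|%:R : R).

Definition rlbound x r := forall n : int, r < n%:~R -> lcoef x n = 0.

Lemma rlbound_le x r r' : r <= r' -> rlbound x r -> rlbound x r'.
Proof. by move=> rr hx n rn; apply: hx; exact: le_lt_trans rn. Qed.

Lemma rlboundB x y r : rlbound x r -> rlbound y r -> rlbound (x - y) r.
Proof. by move=> hx hy n rn; rewrite lcoefB hx ?hy ?subr0. Qed.

Lemma rlbound_int x (a : int) r : a%:~R <= r -> lbound x a -> rlbound x r.
Proof.
by move=> ar hx n rn; apply: hx; rewrite -(ltr_int R); exact: le_lt_trans rn.
Qed.

Lemma int_rlbound x (a : int) r : r < (a + 1)%:~R -> rlbound x r -> lbound x a.
Proof.
move=> ra hx n an; apply: hx; apply: lt_le_trans ra _.
by rewrite ler_int; lia.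
Qed.

Lemma lnorm_le x r : lnorm R x <= q `^ r <-> rlbound x r.
Proof.
have q1 := card_field_gt1 F R; have q0 : 0 < q by apply: lt_trans q1.
rewrite /lnorm; case: eqVneq => [->|x0]; first by rewrite powR_ge0.
have [xd hd] := ldegP x0; rewrite -powR_intmul ?(ltW q0)//.
have -> : (q `^ (ldeg x)%:~R <= q `^ r) = ((ldeg x)%:~R <= r).
  rewrite /powR gt_eqF// ler_expR ler_pM2r ?ln_gt0//.
split=> [dr n rn|hx]; first by apply: hd; rewrite -(ltr_int R); apply: le_lt_trans rn.
by rewrite leNgt; apply/negP => /hx /eqP; rewrite (negPf xd).
Qed.

Lemma ldist_le x r : ldist R x <= q `^ r <-> exists y, rlbound (x - lpoly y) r.
Proof.
have [p [dE dmin]] := ldist_min R x; split=> [|[y hy]].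
  by rewrite dE => /lnorm_le hp; exists p.
by apply: le_trans (dmin y) _; apply/lnorm_le.
Qed.

Let logq (H : R) := ln H / ln q.

Let logqK H : 0 < H -> q `^ logq H = H.
Proof.
have q1 := card_field_gt1 F R; have q0 : 0 < q by apply: lt_trans q1.
by move=> H0; rewrite /powR gt_eqF// divfK ?lnK// gt_eqF// ln_gt0.
Qed.

Let ler_powq r r' : (q `^ r <= q `^ r') = (r <= r').
Proof.
have q1 := card_field_gt1 F R; have q0 : 0 < q by apply: lt_trans q1.
by rewrite /powR gt_eqF// ler_expR ler_pM2r ?ln_gt0.
Qed.

Let powq_gt0 r : 0 < q `^ r.
Proof. by rewrite powR_gt0// (lt_trans _ (card_field_gt1 F R)). Qed.

(* [H = q `^ h] turns the defining inequalities into bounds on degrees. *)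
Definition uniform_exponent xi theta w := exists h0 : R, forall h, h0 <= h ->
  exists x y : {poly F}, rlbound (lpoly x * xi - theta - lpoly y) (- (w * h)) /\
    rlbound (lpoly x) h.

Definition ordinary_exponent xi w := forall h0 : R, exists2 h, h0 <= h &
  exists x y : {poly F}, [/\ x != 0,
    rlbound (lpoly x * xi - lpoly y) (- (w * h)) & rlbound (lpoly x) h].

Let powqN w h : (q `^ h) `^ (- w) = q `^ (- (w * h)).
Proof. by rewrite -powRrM mulrN mulrC. Qed.

Lemma omegaE xi :
  omega R xi = ereal_sup [set w%:E | w in ordinary_exponent xi].
Proof.
rewrite /omega; congr ereal_sup; congr image; apply/seteqP; split=> w hw.
  move=> h0; have [H hH [x [x0 hd hx]]] := hw (q `^ h0).
  have Hq := logqK (lt_le_trans (powq_gt0 h0) hH).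
  move: hH hd hx; rewrite -Hq powqN ler_powq => hH /ldist_le[y hy] /lnorm_le hx.
  by exists (logq H) => //; exists x, y.
move=> H0; have H1 : 0 < Num.max H0 1 by rewrite lt_max ltr01 orbT.
have [h hh [x [y [x0 hd hx]]]] := hw (logq (Num.max H0 1)).
exists (q `^ h).
  by move: hh; rewrite -ler_powq logqK//; apply: le_trans; rewrite le_max lexx.
exists x; split=> //; last exact/lnorm_le.
by rewrite powqN; apply/ldist_le; exists y.
Qed.

Lemma omegahatE xi theta :
  omegahat R xi theta = ereal_sup [set w%:E | w in uniform_exponent xi theta].
Proof.
rewrite /omegahat; congr ereal_sup; congr image; apply/seteqP; split=> w [h0 hw].
  have H1 : 0 < Num.max h0 1 by rewrite lt_max ltr01 orbT.
  exists (logq (Num.max h0 1)) => h hh.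
  have [|x [hd hx]] := hw (q `^ h).
    by move: hh; rewrite -ler_powq logqK//; apply: le_trans; rewrite le_max lexx.
  move: hd hx; rewrite powqN => /ldist_le[y hy] /lnorm_le hx.
  by exists x, y.
exists (q `^ h0) => H hH; have Hq := logqK (lt_le_trans (powq_gt0 h0) hH).
move: hH; rewrite -Hq ler_powq => /hw[x [y [hd hx]]].
exists x; split; last exact/lnorm_le.
by rewrite powqN; apply/ldist_le; exists y.
Qed.

Lemma omega_ge0 xi : (0 <= omega R xi)%E.
Proof.
rewrite omegaE; apply: ereal_sup_ubound; exists 0 => // h0.
have [p hp] := lfracE xi.
exists (Num.max h0 0); first by rewrite le_max lexx.
exists 1, p; split; first exact: oner_neq0.
  rewrite rmorph1 mul1r hp mul0r oppr0 => -[n _|n] //=.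
  by rewrite ltNge lerz0.
by rewrite rmorph1; apply: rlbound_int (@lbound1 F); rewrite le_max lexx orbT.
Qed.

Lemma omegahat_ge0 xi theta : (0 <= omegahat R xi theta)%E.
Proof.
rewrite omegahatE; apply: ereal_sup_ubound; exists 0 => //; exists 0 => h h0.
have [p hp] := lfracE (- theta).
exists 0, p; split; last by rewrite rmorph0 => n.
rewrite rmorph0 mul0r add0r hp mul0r oppr0 => -[n _|n] //=.
by rewrite ltNge lerz0.
Qed.

(** Solutions [u n] are chosen at the integer scales h = n. A nonzero difference of [u n.+1] and
    [u n] gives exponent [w] measured against [n] instead of [n.+1]; passing to any [w' < w] absorbs
    this loss. *)
Lemma omegahat_le_omega xi theta : ~ lpolyspan xi theta ->
  (omegahat R xi theta <= omega R xi)%E.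
Proof.
move=> hspan; rewrite omegahatE; apply/ereal_supP => _ [w [h0 hw] <-].
have [w0|w0] := leP w 0; first by apply: le_trans (omega_ge0 xi); rewrite lee_fin.
apply: lee_real => w'; rewrite lte_fin => ww.
have [w'0|w'0] := leP w' 0; first by apply: le_trans (omega_ge0 xi); rewrite lee_fin.
rewrite omegaE; apply: ereal_sup_ubound; exists w' => //.
pose N := Num.bound h0.
have hN (n : nat) : (N <= n)%N -> h0 <= n%:R.
  rewrite -(ler_nat R) => Nn; apply: le_trans Nn.
  by rewrite ltW// unstable.ltr_bound.
have hxy n : exists xy : {poly F} * {poly F}, (N <= n)%N ->
    rlbound (lpoly xy.1 * xi - theta - lpoly xy.2) (- (w * n%:R)) /\
    rlbound (lpoly xy.1) n%:R.
  have [/hN/hw[x [y hxy]]|nN] := leqP N n; first by exists (x, y).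
  by exists (0, 0).
have [u hu] := choice hxy.
have [stat|nstat] := pselect (exists n0, forall n, (n0 <= n)%N -> (u n.+1).1 = (u n).1).
  have [n0 hn0] := stat; exfalso; apply: hspan.
  pose m := maxn n0 N.+1; pose x := (u m).1; pose y := (u m).2.
  have xE k : (u (m + k)%N).1 = x.
    by elim: k => [|k IH]; rewrite ?addn0// addnS hn0 ?IH// /m; lia.
  have hm k : rlbound (lpoly x * xi - theta - lpoly (u (m + k)%N).2)
      (- (w * (m + k)%N%:R)).
    by have [|h1 _] := hu (m + k)%N; [rewrite /m; lia | rewrite -(xE k)].
  have wm k : 0 < w * (m + k)%N%:R by rewrite mulr_gt0// ltr0n /m; lia.
  (* Both errors have negative degree, so the two polynomial parts differ by a polynomial of
     negative degree, which is 0. *)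
  have yE k : (u (m + k)%N).2 = y.
    apply/eqP; rewrite -subr_eq0; apply/eqP/(@lbound_poly_lt0 _ _ (-1)) => //.
    rewrite rmorphB /=.
    have -> : lpoly (u (m + k)%N).2 - lpoly y =
      (lpoly x * xi - theta - lpoly y) - (lpoly x * xi - theta - lpoly (u (m + k)%N).2).
      by ring.
    have := hm 0%N; rewrite addn0 -/y => hm0; have wm0 := wm 0%N.
    rewrite addn0 in wm0.
    by apply: lboundB; [apply: int_rlbound hm0|apply: int_rlbound (hm k)];
      rewrite addNr oppr_lt0.
  (* The fixed error now satisfies the bounds of all later scales, so each of its coefficients
     vanishes. *)
  have t0 : lpoly x * xi - theta - lpoly y = 0.
    apply: laurentP => n; rewrite lcoef0 -(yE (Num.bound (`|n|%N%:R / w))); apply: hm.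
    have := unstable.ltr_bound (`|n|%N%:R / w); rewrite ltr_pdivrMr// natrD => hb.
    have hn : - n%:~R <= `|n|%N%:R :> R by rewrite -mulrNz pmulrn ler_int; lia.
    have := ler0n R m; nra.
  exists (- y), x; rewrite rmorphN /= -[theta]addr0 -t0; ring.
move=> h1.
(* Beyond this threshold [w' * n.+1 <= w * n]. *)
pose M := maxn N (Num.bound (Num.max h1 (w' / (w - w')))).
have [n Mn un] : exists2 n, (M <= n)%N & (u n.+1).1 != (u n).1.
  apply: contrapT => nex; apply: nstat; exists M => n Mn; apply: contrapT => un.
  by apply: nex; exists n => //; exact/eqP.
have nb : Num.max h1 (w' / (w - w')) < n%:R.
  apply: lt_le_trans (unstable.ltr_bound _) _.
  by rewrite ler_nat (leq_trans _ Mn)// leq_maxr.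
move: nb; rewrite gt_max ltr_pdivrMr ?subr_gt0// => /andP[nh1 nw].
exists n.+1%:R; first by rewrite -natr1; lra.
have [|a1 b1] := hu n.+1; first by rewrite (leq_trans (leq_maxl _ _) (leq_trans Mn _)).
have [|a2 b2] := hu n; first by rewrite (leq_trans (leq_maxl _ _) Mn).
exists ((u n.+1).1 - (u n).1), ((u n.+1).2 - (u n).2); rewrite !rmorphB /=.
split; first by rewrite subr_eq0.
  set A := lpoly (u n.+1).1 in a1 *; set B := lpoly (u n).1 in a2 *.
  have -> : (A - B) * xi - (lpoly (u n.+1).2 - lpoly (u n).2) =
     (A * xi - theta - lpoly (u n.+1).2) - (B * xi - theta - lpoly (u n).2) by ring.
  by apply: rlboundB; [apply: rlbound_le a1|apply: rlbound_le a2];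
    rewrite lerN2 -natr1; nra.
by apply: rlboundB => //; apply: rlbound_le b2; rewrite ler_nat.
Qed.

End LogScale.

(** * Duality through Hankel matrices, and the lower bound *)

Section Transference.
Variables (F : finFieldType) (R : realType).
Implicit Types (xi theta : laurent F).

Lemma lcoef_polyM xi (x : {poly F}) (n : nat) (c : int) : (size x <= n)%N ->
  lcoef (lpoly x * xi) c = \sum_(i < n) x`_i * lcoef xi (c - i%:Z).
Proof.
move=> sx; rewrite [LHS](@lconv_seq _ _ _ _ [seq Posz k | k <- iota 0 n]).
- by rewrite big_map -{1}[n]subn0 -/(index_iota 0 n) big_mkord.
- by rewrite map_inj_uniq ?iota_uniq// => i j [].
move=> [i|i]; last by rewrite /= mul0r.
have [lein|ltni _] := ltnP i n; first by rewrite map_f// mem_iota.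
by rewrite /= nth_default ?mul0r//; apply: leq_trans ltni.
Qed.

Lemma lbound_frac (x : laurent F) (n : nat) :
  (forall i, (i < n)%N -> lcoef x (- i.+1%:Z) = 0) ->
  exists p, lbound (x - lpoly p) (- n.+1%:Z).
Proof.
move=> hx; have [p hp] := lfracE x; exists p; rewrite hp => -[k|k] //= nk.
by rewrite NegzE hx//; lia.
Qed.

(* The Hankel matrix of xi gives the first m fractional digits of x xi, for x of
   degree < n; it is onto as soon as its transpose, which is again a Hankel matrix
   of xi, is injective. *)
Lemma transference xi theta (n m : nat) :
  (forall y p : {poly F}, y != 0 -> (size y <= m)%N ->
     ~ lbound (lpoly y * xi - lpoly p) (- n.+1%:Z)) ->
  exists x p : {poly F}, (size x <= n)%N /\
    lbound (lpoly x * xi - theta - lpoly p) (- m.+1%:Z).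
Proof.
move=> hom; pose A := \matrix_(i < n, j < m) lcoef xi (- (i + j).+1%:Z).
have AE a (v : 'rV[F]_a) i : lcoef (lpoly (rVpoly v) * xi) (- i.+1%:Z) =
    \sum_(k < a) v 0 k * lcoef xi (- (k + i).+1%:Z).
  rewrite (lcoef_polyM _ _ (size_poly _ _)); apply: eq_bigr => k _.
  by rewrite coef_rVpoly_ord; congr (_ * lcoef xi _); lia.
(* A kernel vector is a polynomial y of degree < m such that the first n fractional digits of y xi
   vanish, which [hom] forbids unless y = 0. *)
have freeT : row_free A^T.
  apply: inj_row_free => v vA; apply/eqP; apply: contraT => v0; exfalso.
  have [|p hp] := @lbound_frac (lpoly (rVpoly v) * xi) n.
    move=> i im; have := congr1 (fun M : 'rV_n => M 0 (Ordinal im)) vA.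
    rewrite !mxE AE => vAi; rewrite -[RHS]vAi; apply: eq_bigr => k _.
    by rewrite !mxE /= addnC.
  apply: hom hp; last exact: size_poly.
  by apply: contra v0 => /eqP p0; rewrite -(rVpolyK v) p0 linear0.
have full : row_full A by move: freeT; rewrite /row_free /row_full mxrank_tr.
have /submxP[u uA] := submx_full (\row_(j < m) lcoef theta (- j.+1%:Z)) full.
have [|p hp] := @lbound_frac (lpoly (rVpoly u) * xi - theta) m.
  move=> j jm; rewrite lcoefB AE.
  have := congr1 (fun M : 'rV_m => M 0 (Ordinal jm)) uA; rewrite !mxE => ->.
  by apply/eqP; rewrite subr_eq0; apply/eqP; apply: eq_bigr => k _; rewrite !mxE.
by exists (rVpoly u), p; split=> //; exact: size_poly.
Qed.

(** For 0 < r < 1/omega, the number 1/r is not an ordinary exponent. So for large h no nonzero y of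
    degree at most r h has y xi within degree -h of a polynomial, and [transference] solves the
    inhomogeneous system with exponent r. *)
Lemma inv_omega_le_omegahat xi theta :
  ((omega R xi)^-1 <= omegahat R xi theta)%E.
Proof.
apply: lee_real => r rw.
have [r0|r0] := leP r 0; first by apply: le_trans (omegahat_ge0 _ _ _); rewrite lee_fin.
have wr : (omega R xi < (r^-1)%:E)%E.
  have := @inve_pgt R r%:E (omega R xi); rewrite !inE lee_fin (ltW r0) omega_ge0.
  by move=> /(_ isT isT); rewrite rw inver gt_eqF// => <-.
have nord : ~ ordinary_exponent xi r^-1.
  move=> ho; move: wr; rewrite ltNge => /negP; apply.
  by rewrite omegaE; apply: ereal_sup_ubound; exists r^-1.
have [h0 hh0] : exists h0 : R, forall h, h0 <= h -> forall x y : {poly F}, x != 0 ->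
    rlbound (lpoly x * xi - lpoly y) (- (r^-1 * h)) -> ~ rlbound (lpoly x) h.
  apply: contrapT => nex; apply: nord => h0; apply: contrapT => nh; apply: nex.
  exists h0 => h hh x y x0 h1 h2; apply: nh; exists h => //; by exists x, y.
rewrite omegahatE; apply: ereal_sup_ubound; exists r => //.
exists (Num.max (h0 / r) 0) => h; rewrite ge_max ler_pdivrMr// => /andP[hr h0'].
have rh0 : 0 <= r * h by rewrite mulr_ge0// ltW.
have /andP[tm _] := truncn_itv rh0; have := truncnS_gt (r * h).
set m := Num.truncn (r * h) in tm * => mt.
have /andP[tn _] := truncn_itv h0'; have := truncnS_gt h.
set n := Num.truncn h in tn * => nt.
(* With n and m the integer parts of h and r h, the solution has degree at most n <= h and error
   degree at most -(m + 1) < -r h. *)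
have [|x [p [sx hp]]] := @transference xi theta n.+1 m.
  move=> y p y0 sy hy; apply: (hh0 (r * h) _ y p) => //.
  - by rewrite mulrC.
  - rewrite mulKf ?gt_eqF//; apply: rlbound_int hy.
    by rewrite mulrNz lerN2 -pmulrn -natr1; lra.
  - apply: (@rlbound_int _ _ _ m); first by rewrite -pmulrn.
    by apply: lbound_poly; exact: leqW.
exists x, p; split.
  by apply: rlbound_int hp; rewrite mulrNz lerN2 -pmulrn ltW.
by apply: (@rlbound_int _ _ _ n); [rewrite -pmulrn|exact: lbound_poly].
Qed.

End Transference.

(** * Exponents of the constructed xi and theta *)

Section Spectrum.
Variables (F : finFieldType) (R : realType).

(** Convergence in the extended reals, in a one-sided form that fits [lee_real] and treats finite
    and infinite limits alike. *)
Definition tends_to (u : nat -> R) (a : \bar R) :=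
  (forall r : R, (r%:E < a)%E -> exists K, forall k, (K <= k)%N -> r <= u k) /\
  (forall r : R, (a < r%:E)%E -> exists K, forall k, (K <= k)%N -> u k <= r).

Variable W : nat -> R.
Hypothesis W1 : forall k, 1 <= W k.

(** The next term is floor(W_k d_k) + 1, written so that strict growth is visible. *)
Fixpoint degree_seq (k : nat) : nat :=
  if k is j.+1 then (degree_seq j + Num.truncn ((W j - 1) * (degree_seq j)%:R)).+1
  else 0%N.
Local Notation d := degree_seq.

Lemma degree_seq_lt k : (d k < d k.+1)%N.
Proof. by rewrite /= ltnS leq_addr. Qed.

Lemma degree_seq_ge k : (k%:R : R) <= (d k)%:R.
Proof.
by rewrite ler_nat; elim: k => // k IH; apply: leq_ltn_trans IH (degree_seq_lt k).
Qed.

Lemma degree_seq_bounds k :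
  W k * (d k)%:R < (d k.+1)%:R /\ (d k.+1)%:R <= W k * (d k)%:R + 1.
Proof.
have h : 0 <= (W k - 1) * (d k)%:R by rewrite mulr_ge0// subr_ge0.
have /andP[] := truncn_itv h; rewrite [d k.+1]/= -!natr1 natrD.
by split; lra.
Qed.

Variables (xi : laurent F) (q p : nat -> {poly F}).
Hypothesis xi_conv : forall k, size (q k) = (d k).+1 /\
  leads (lpoly (q k) * xi - lpoly (p k)) (- (d k.+1)%:Z).

(** For d_k <= h < d_(k+1) no error has degree below -d_(k+1), and q_k attains this at h = d_k;
    hence the ratios d_(k+1)/d_k decide the exponent. *)
Lemma omega_degree_seq w : tends_to W w -> omega R xi = w.
Proof.
move=> [Wlow Wup]; rewrite omegaE; apply/le_anti/andP; split.
  apply/ereal_supP => _ [t ht <-]; apply: lee_real => r rt; rewrite leNgt.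
  rewrite lte_fin in rt; apply/negP => /Wup[K hK].
  (* Ensures (t - r) d_k > 1, which absorbs the rounding in d_(k+1) <= W_k d_k + 1. *)
  pose N := maxn K (Num.bound (1 / (t - r))).
  have [h hN [x [y [x0 hy hx]]]] := ht (d N)%:R.
  have [k Nk /andP[dk kd]] := unbounded_bracket degree_seq_ge hN.
  have Wk := hK k (leq_trans (leq_maxl _ _) Nk).
  have [_ dd] := degree_seq_bounds k; have W1k := W1 k.
  have bk : 1 / (t - r) < (d k)%:R.
    apply: lt_le_trans (degree_seq_ge k); apply: lt_le_trans (unstable.ltr_bound _) _.
    by rewrite ler_nat (leq_trans _ Nk)// leq_maxr.
  rewrite ltr_pdivrMr ?subr_gt0// in bk.
  apply: (homogeneous_lower degree_seq_lt xi_conv (k := k) (erefl _) x0 (y := y)).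
    have := @int_rlbound _ _ _ ((d k.+1)%:Z - 1) _ _ hx; rewrite subrK -pmulrn => /(_ kd).
    have dp : (d k.+1).-1.+1 = d k.+1 by [].
    have -> : (d k.+1)%:Z - 1 = (d k.+1).-1 by rewrite -{1}dp; lia.
    by move=> /lbound_polyP; rewrite dp.
  apply: int_rlbound hy; rewrite subrK mulrNz ltrN2 -pmulrn.
  have d0k := ler0n R (d k); nra.
apply: lee_real => r /Wlow[K hK]; apply: ereal_sup_ubound; exists r => // h0.
pose k := maxn K (Num.bound h0).
exists (d k)%:R.
  apply: le_trans (degree_seq_ge k); rewrite ltW//.
  by apply: lt_le_trans (unstable.ltr_bound _) _; rewrite ler_nat leq_maxr.
have [sq [_ hq]] := xi_conv k.
exists (q k), (p k); split; first by rewrite -size_poly_gt0 sq.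
  apply: rlbound_int hq; rewrite mulrNz lerN2 -pmulrn.
  have [dd _] := degree_seq_bounds k; have := hK k (leq_maxl _ _).
  have := ler0n R (d k); nra.
by apply: (@rlbound_int _ _ _ (d k)); [rewrite -pmulrn|apply: lbound_poly; rewrite sq].
Qed.

Variable V : nat -> R.
Hypotheses (V_gt : forall k, (W k)^-1 <= V k) (V_lt : forall k, V k <= W k).

Lemma V_gt0 k : 0 < V k.
Proof. by apply: lt_le_trans (V_gt k); rewrite invr_gt0 (lt_le_trans _ (W1 k)). Qed.

(* The offset solving (W_k d_k - e) / (d_k + e) = V_k. *)
Definition offset k : nat := Num.truncn ((W k - V k) / (1 + V k) * (d k)%:R).
Local Notation e := offset.

Lemma offset_arg_ge0 k : 0 <= (W k - V k) / (1 + V k) * (d k)%:R.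
Proof.
by rewrite mulr_ge0// divr_ge0 ?subr_ge0// ltW// ltr_wpDl// V_gt0.
Qed.

(** The inequality (W - V) / (1 + V) <= W - 1 amounts to 1 <= W V, which is the lower bound on V. *)
Lemma offset_lt k : (e k < d k.+1 - d k)%N.
Proof.
have v0 := V_gt0 k.
suff : (e k <= Num.truncn ((W k - 1) * (d k)%:R))%N by rewrite [d k.+1]/=; lia.
apply/le_truncn/ler_wpM2r => //; rewrite ler_pdivrMr; last by lra.
have := V_gt k; rewrite -(ler_pM2l (lt_le_trans ltr01 (W1 k))) divff; last first.
  by rewrite gt_eqF// (lt_le_trans _ (W1 k)).
by nra.
Qed.

Lemma offset_bounds k :
  V k * ((d k)%:R + (e k)%:R) <= (d k.+1 - e k)%N%:R /\
  (d k.+1 - e k)%N%:R <= V k * ((d k)%:R + (e k)%:R + 1) + 2 :> R.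
Proof.
have v0 := V_gt0 k; have [d1 d2] := degree_seq_bounds k.
have /andP[e1] := truncn_itv (offset_arg_ge0 k); rewrite -/(e k) -natr1.
have elt := offset_lt k; rewrite natrB; last by lia.
move: e1; set E := _ * _ => e1 e2.
have EE : W k * (d k)%:R - E = V k * ((d k)%:R + E).
  by rewrite /E; field; rewrite gt_eqF//; lra.
by split; nra.
Qed.

Variables (theta : laurent F) (X Y : nat -> {poly F}).
Hypothesis theta_app : forall k, leads (theta - (lpoly (X k) * xi - lpoly (Y k)))
      (- (d k.+1 - e k)%N%:Z) /\
    (size (X k) <= d k)%N /\ (size (X k.+1) <= (d k + e k).+1)%N.

Let theta_lower k (x y : {poly F}) : (size x <= d k + e k)%N ->
  ~ lbound (lpoly x * xi - theta - lpoly y) (- (d k.+1 - e k)%N%:Z - 1).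
Proof.
move=> sx; have [h1 [h2 _]] := theta_app k.
exact: (inhomogeneous_lower degree_seq_lt xi_conv offset_lt h1 h2 sx).
Qed.

(** A representation of theta would give an approximation with error 0, against [theta_lower] at an
    index k with d_k at least the size of Q. *)
Lemma theta_notin_span : ~ lpolyspan xi theta.
Proof.
move=> [P [Q tE]]; apply: (@theta_lower (size Q) Q (- P)).
  apply: leq_trans (leq_addr _ _); rewrite -(ler_nat R); exact: degree_seq_ge.
by rewrite tE rmorphN /= => n _; rewrite (_ : _ - _ - _ = 0) ?lcoef0//; ring.
Qed.

(** The worst scale is h just below d_k + e_k, where [X k.+1] is not yet allowed; from there up to
    the next such value [X k.+1] serves. *)
Lemma omegahat_offset v : tends_to V v -> omegahat R xi theta = v.
Proof.
move=> [Vlow Vup]; rewrite omegahatE.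
pose f k : R := (d k + e k)%N%:R.
have fk k : k%:R <= f k by rewrite /f natrD ler_wpDr// degree_seq_ge.
apply/le_anti/andP; split.
  apply/ereal_supP => _ [t [h0 ht] <-]; apply: lee_real => r rt; rewrite leNgt.
  rewrite lte_fin in rt; apply/negP => /Vup[K hK].
  (* Chosen so that f k - 1 >= h0 and r (f k + 1) + 2 < t (f k - 1); the successor makes d_k
     positive. *)
  pose k := (maxn K (Num.bound (Num.max (h0 + 1) ((t + r + 2) / (t - r))))).+1.
  have Vk := hK k (leqW (leq_maxl _ _)).
  have [_ hd] := offset_bounds k; have v0 := V_gt0 k.
  have : Num.max (h0 + 1) ((t + r + 2) / (t - r)) < f k.
    apply: lt_le_trans (fk k); apply: lt_le_trans (unstable.ltr_bound _) _.
    by rewrite ler_nat; apply/leqW/leq_maxr.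
  rewrite gt_max ltr_pdivrMr ?subr_gt0// => /andP[fh ft].
  have [|x [y [hy hx]]] := ht (f k - 1); first by lra.
  have dp : (d k + e k).-1.+1 = (d k + e k)%N by [].
  apply: (@theta_lower k x y).
    have := @int_rlbound _ _ _ ((d k + e k)%N.-1)%:Z _ _ hx.
    have -> : ((d k + e k).-1%:Z + 1) = (d k + e k)%N by rewrite -{2}dp; lia.
    rewrite -pmulrn => h; rewrite -dp; apply/lbound_polyP/h; rewrite /f; lra.
  apply: int_rlbound hy; rewrite subrK mulrNz ltrN2 -pmulrn.
  have fE : f k = (d k)%:R + (e k)%:R by rewrite /f natrD.
  by rewrite -fE in hd; have := fk k; have := ler0n R k; nra.
apply: lee_real => r /Vlow[K hK]; apply: ereal_sup_ubound; exists r => //.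
exists (Num.max 0 (f K)) => h; rewrite ge_max => /andP[h0 hf].
have [k Kk /andP[f1 f2]] := unbounded_bracket fk hf.
have [_ [_ sX]] := theta_app k; have [[_ hX] _] := theta_app k.+1.
exists (X k.+1), (Y k.+1); split; last first.
  by apply: (@rlbound_int _ _ _ (d k + e k)%N); [rewrite -pmulrn|exact: lbound_poly].
have -> : lpoly (X k.+1) * xi - theta - lpoly (Y k.+1) =
  - (theta - (lpoly (X k.+1) * xi - lpoly (Y k.+1))) by ring.
apply: rlbound_int (lboundN hX); rewrite mulrNz lerN2 -pmulrn.
have [hd _] := offset_bounds k.+1; have v0 := V_gt0 k.+1.
have Vk := hK k.+1 (leqW Kk); rewrite -natrD -/(f k.+1) in hd.
have [r0|r0] := leP r 0; nra.
Qed.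

End Spectrum.

(** * Every value of the interval is attained *)

Section Attained.
Variables (F : finFieldType) (R : realType).

Lemma tends_to_cst (r : R) : tends_to (fun=> r) r%:E.
Proof. by split=> r'; rewrite lte_fin => /ltW rr; exists 0%N. Qed.

Lemma tends_to_natS : tends_to (fun k => k.+1%:R : R) +oo%E.
Proof.
split=> r //; exists (Num.bound r) => k rk; apply: ltW.
by apply: lt_le_trans (unstable.ltr_bound r) _; rewrite ler_nat leqW.
Qed.

(** xi is built from [W] alone, before [V] is given, so a single xi serves all values v. *)
Lemma spectrum_attained (W : nat -> R) (w : \bar R) :
  (forall k, 1 <= W k) -> tends_to W w ->
  exists2 xi : laurent F, omega R xi = w &
    forall (V : nat -> R) (v : \bar R), (forall k, (W k)^-1 <= V k) ->
      (forall k, V k <= W k) -> tends_to V v ->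
      exists2 theta, ~ lpolyspan xi theta & omegahat R xi theta = v.
Proof.
move=> W1 Ww.
have [xi [q [p conv]]] := @exists_convergents F _ (degree_seq_lt W) (erefl _).
exists xi; first exact: (omega_degree_seq W1 conv Ww).
move=> V v V1 V2 Vv.
have [theta [X [Y app]]] := 
  exists_inhomogeneous (degree_seq_lt W) conv (offset_lt W1 V1).
exists theta; first exact: (theta_notin_span W1 conv V1 app).
exact: (omegahat_offset W1 conv V1 V2 app Vv).
Qed.

Lemma invS_le k : k.+1%:R^-1 <= k.+1%:R :> R.
Proof. by apply: (@le_trans _ _ 1); rewrite ?invf_le1 ?ler1n. Qed.

(** Clamping r to [1/(k+1), k+1] makes it admissible for W_k = k + 1, including r = 0. *)
Lemma tends_to_trunc (r : R) : 0 <= r ->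
  exists2 V : nat -> R, tends_to V r%:E &
    forall k, k.+1%:R^-1 <= V k /\ V k <= k.+1%:R.
Proof.
move=> r0; exists (fun k => Num.max k.+1%:R^-1 (Num.min r k.+1%:R)); last first.
  by move=> k; rewrite le_max lexx ge_max ge_min lexx orbT andbT invS_le.
split=> s; rewrite lte_fin => rs.
  exists (Num.bound r) => k rk; rewrite le_max le_min (ltW rs) orbC.
  have : r < k.+1%:R.
    by apply: lt_le_trans (unstable.ltr_bound r) _; rewrite ler_nat leqW.
  by move=> rk1; rewrite (ltW (lt_trans rs rk1)).
have s0 : 0 < s by apply: le_lt_trans rs.
exists (Num.bound s^-1) => k rk; rewrite ge_max ge_min (ltW rs) andbT.
rewrite -[s]invrK lef_pV2 ?posrE ?invr_gt0//; apply: ltW.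
by apply: lt_le_trans (unstable.ltr_bound _) _; rewrite ler_nat leqW.
Qed.

End Attained.

Local Close Scope ring_scope.
Local Open Scope ereal_scope.

Theorem theorem2p3 (F : finFieldType) (R : realType) :
  (forall xi : laurent F, ~ lrational xi ->
     forall theta : laurent F, ~ lpolyspan xi theta ->
       (omega R xi)^-1 <= omegahat R xi theta /\
       omegahat R xi theta <= omega R xi) /\
  (forall w : \bar R, w = +oo \/ (exists2 r : R, (1 <= r)%R & w = r%:E) ->
     exists2 xi : laurent F, omega R xi = w &
       [set omegahat R xi theta | theta in ~` lpolyspan xi] = `[w^-1, w]).
Proof.
split=> [xi _ theta span|w hw].
  by split; [exact: inv_omega_le_omegahat|exact: omegahat_le_omega].
suff [xi xiw hv] : exists2 xi : laurent F, omega R xi = w & forall v, w^-1 <= v ->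
    v <= w -> exists2 theta, ~ lpolyspan xi theta & omegahat R xi theta = v.
  exists xi => //; apply/seteqP; split=> [_ [theta span <-]|v] /=; rewrite in_itv /=.
    by rewrite -xiw inv_omega_le_omegahat omegahat_le_omega.
  by move=> /andP[v1 v2]; have [theta] := hv v v1 v2; exists theta.
case: hw => [->|[r r1 ->]].
  have W1 k : (1 <= k.+1%:R :> R)%R by rewrite ler1n.
  have [xi xiw hv] := @spectrum_attained F R _ _ W1 (@tends_to_natS R).
  (* For omega = +oo, real values come from clamped sequences and +oo from V = W. *)
  exists xi => // -[r||]; rewrite invey ?leNye//.
    rewrite lee_fin => r0 _; have [V Vr VW] := tends_to_trunc r0.
    by apply: hv Vr => k; case: (VW k).
  move=> _ _; apply: hv (@tends_to_natS R) => // k; exact: invS_le.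
have r0 : (0 < r)%R by apply: lt_le_trans r1.
have [xi xiw hv] := @spectrum_attained F R _ _ (fun=> r1) (tends_to_cst r).
exists xi => // -[s||]; rewrite inver gt_eqF// ?lee_fin; [|by []..].
by move=> rs sr; apply: hv (tends_to_cst s).
Qed.
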